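(* Let $0<a<1$ and $f\in H^2(\mathbb{D})$. If $0<|Z(f)|<\infty$, then $\dim K_f\geq 2$.
   Context: $H^2=H^2(\mathbb{D})$ is the Hardy-Hilbert space of holomorphic functions on the open unit disk $\mathbb{D}$. For $a\in(0,1)$, $\phi_a(z)=az+1-a$, a holomorphic self-map of $\mathbb{D}$, and $C_{\phi_a}f=f\circ\phi_a$ is the (bounded) composition operator on $H^2$. For $f\in H^2$, $K_f:=\overline{\mathrm{span}\{f,C_{\phi_a}f,C_{\phi_a}^2f,\ldots\}}$ (closure in $H^2$). $Z(f)$ denotes the set of zeros of $f$ in $\mathbb{D}$ and $|Z(f)|$ its cardinality. *)

(* Defs.v *)
From HB Require Import structures.
From mathcomp Require Import all_boot all_order all_algebra.
From mathcomp Require Import complex.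
From mathcomp Require Import all_classical all_reals all_analysis.

Set Implicit Arguments.
Unset Strict Implicit.
Unset Printing Implicit Defensive.

Import Order.TTheory GRing.Theory Num.Theory.
Import numFieldNormedType.Exports.

Local Open Scope classical_set_scope.
Local Open Scope ring_scope.
Local Open Scope complex_scope.

Definition disk (R : realType) := {z : R[i] | `|z| < 1}.

(* The codomain is the regular module R[i]^o, through which R[i] gets both its
   topology and its structure of vector space over itself. *)
Definition disk_fun (R : realType) : lmodType R[i] := disk R -> R[i]^o.

Section Hardy.
Variable R : realType.
Implicit Types f g h : disk_fun R.

(* [c] is the sequence of Taylor coefficients of [f] at 0. A function on the
   disk has such a sequence if and only if it is holomorphic, and the sequence
   is then unique. *)
Definition is_taylor f (c : nat -> R[i]) :=
  forall z : disk R,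
    series (fun n => c n * val z ^+ n : R[i]^o) @ \oo --> (f z : R[i]^o).

Definition taylor_coef f : nat -> R[i] := xget (fun=> 0) (is_taylor f).

Definition hardy_normsq f : \bar R :=
  (\sum_(0 <= n <oo) (Normc.normc (taylor_coef f n) ^+ 2)%:E)%E.

Definition hardy_norm f : R := Num.sqrt (fine (hardy_normsq f)).

Definition hardy2 : set (disk_fun R) :=
  [set f | (exists c, is_taylor f c) /\ (hardy_normsq f < +oo)%E].

Definition zeros f : set (disk R) := [set z | f z = 0].

Lemma affine_disk (a : R) (a01 : 0 < a < 1) (z : disk R) :
  `|a%:C * val z + (1 - a)%:C| < 1.
Proof.
case/andP: a01 => a0 a1; case: z => z /= z1.
apply: (le_lt_trans (ler_normD _ _)).
have na : `|a%:C| = a%:C by rewrite ger0_norm// ler0c ltW.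
have nb : `|(1 - a)%:C| = (1 - a)%:C by rewrite ger0_norm// ler0c subr_ge0 ltW.
rewrite normrM na nb rmorphB rmorph1 addrCA gtrDl.
by rewrite -[X in _ - X]mulr1 -mulrBr pmulr_rlt0 ?ltcR// subr_lt0.
Qed.

Definition affine_symbol (a : R) (a01 : 0 < a < 1) (z : disk R) : disk R :=
  exist _ (a%:C * val z + (1 - a)%:C) (affine_disk a01 z).

Definition comp_op (phi : disk R -> disk R) f : disk_fun R := f \o phi.

Definition orbit_span (phi : disk R -> disk R) f : set (disk_fun R) :=
  [set h | exists (N : nat) (k : nat -> R[i]),
    h = \sum_(n < N) k n *: iter n (comp_op phi) f].

(* Closure of [orbit_span phi f] in the normed space H^2. *)
Definition cyclic_subspace (phi : disk R -> disk R) f : set (disk_fun R) :=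
  [set g | hardy2 g /\ forall e : R, 0 < e ->
    exists2 h, orbit_span phi f h & hardy_norm (g - h) < e].

End Hardy.

(* [n <= dim K] for a linear subspace [K], possibly of infinite dimension. *)
Definition dim_ge (F : fieldType) (V : lmodType F) (K : set V) (n : nat) :=
  exists v : 'I_n -> V, (forall i, K (v i)) /\
    forall k : 'I_n -> F, \sum_(i < n) k i *: v i = 0 -> forall i, k i = 0.

(* Main.v *)
Require Import Defs.
From mathcomp Require Import all_boot all_order all_algebra.
From mathcomp Require Import complex.
From mathcomp Require Import all_classical all_reals all_analysis.
From mathcomp Require Import ring lra.

(** Write phi(z) = a z + 1 - a and C f = f \o phi. The two vectors are f and
    C f.

    They are independent. If k0 f + k1 C f = 0 with k1 <> 0, then C f is a
    scalar multiple of f; if k1 = 0 and k0 <> 0, then f = 0 and again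
    C f = 0 *: f. But when C f = l *: f, the zeros of f are mapped to zeros of
    f by phi, and since 1 - phi^n(w) = a^n (1 - w) with w <> 1, the orbit of
    one zero w consists of infinitely many points
    ([eigenfunction_zeros]). This contradicts the finiteness of the zero set.

    They lie in the cyclic subspace. Both are in the span of the orbit, so the
    point is that C f is in H^2 ([hardy2_comp_affine]). Expanding
    (a z + 1 - a)^n by powers of z shows that C acts on Taylor coefficients by
    the nonnegative matrix whose (k, n) entry is the coefficient of X^k in
    (a X + 1 - a)^n. Its entries of fixed n sum to 1 (evaluate at X = 1), and
    those of fixed k sum to at most 1 / a, so the Schur test
    ([affine_coef_schur]) bounds the squared norm of C f by 1 / a times that
    of f. That the transformed sequence is indeed a Taylor sequence of C f is
    [power_series_affine_comp]; that the H^2 norm may be computed from it is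
    the uniqueness of Taylor coefficients ([power_series_eq0]). *)

Set Implicit Arguments.
Unset Strict Implicit.
Unset Printing Implicit Defensive.

Import Order.TTheory GRing.Theory Num.Theory.
Import numFieldNormedType.Exports.
Import Normc.

Local Open Scope classical_set_scope.
Local Open Scope ring_scope.
Local Open Scope complex_scope.

Local Notation "u ~~>C l" :=
  ((u : nat -> _[i]^o) @ \oo --> (l : _[i]^o)) (at level 70, l at next level).

(** * Convergence of complex sequences through the real modulus *)

Section ComplexSeries.
Variable R : realType.
Implicit Types (u v : nat -> R[i]) (l z : R[i]).

Lemma normr_normc z : `|z| = (normc z)%:C.
Proof. by case: z. Qed.

Lemma normc_ge0 z : 0 <= normc z.
Proof. by case: z => x y; exact: sqrtr_ge0. Qed.

Lemma normcX z n : normc (z ^+ n) = normc z ^+ n.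
Proof. by elim: n => [|n IH]; rewrite ?expr0 ?normc1// !exprS normcM IH. Qed.

Lemma normc_realC (x : R) : 0 <= x -> normc x%:C = x.
Proof.
by move=> x0; apply: complexI; rewrite -normr_normc ger0_norm// ler0c.
Qed.

Lemma normc_sum (I : Type) (r : seq I) (P : pred I) (F : I -> R[i]) :
  normc (\sum_(i <- r | P i) F i) <= \sum_(i <- r | P i) normc (F i).
Proof.
elim/big_ind2 : _ => [|x1 x2 y1 y2 h1 h2|//]; first by rewrite normc0.
by rewrite (le_trans (le_normcD _ _))// lerD.
Qed.

Lemma normc_le_ReIm z : normc z <= `|complex.Re z| + `|complex.Im z|.
Proof.
case: z => x y /=; rewrite -[leRHS]ger0_norm ?addr_ge0// -sqrtr_sqr.
rewrite ler_wsqrtr// sqrrD !real_normK ?num_real//.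
rewrite addrAC lerDl mulrn_wge0// mulr_ge0.
Qed.

Lemma normr_Re_le z : `|complex.Re z| <= normc z.
Proof.
case: z => x y /=; rewrite -sqrtr_sqr ler_wsqrtr// lerDl sqr_ge0//.
Qed.

Lemma normr_Im_le z : `|complex.Im z| <= normc z.
Proof.
case: z => x y /=; rewrite -sqrtr_sqr ler_wsqrtr// lerDr sqr_ge0//.
Qed.

Lemma cvgcP u l : u ~~>C l <->
  (normc (u n - l) @[n --> \oo] --> 0).
Proof.
split.
  move=> /cvgrPdist_le ul; apply/cvgr0Pnorm_le => e e0.
  have e0' : 0 < e%:C by rewrite ltcR.
  have := ul _ e0'; apply: filterS => n.
  by rewrite [in X in _ -> X]ger0_norm ?normc_ge0// distrC normr_normc lecR.
move=> /cvgr0Pnorm_le ul; apply/cvgrPdist_le => e e0.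
have [e0' eE] : 0 < complex.Re e /\ e = (complex.Re e)%:C.
  move: e0; rewrite ltcE /= => /andP[/eqP e1 e2]; split=> //.
  by case: e e1 e2 => ? ? /= ->.
have := ul _ e0'; apply: filterS => n.
rewrite [in X in X -> _]ger0_norm ?normc_ge0// distrC normr_normc.
by rewrite [in X in _ -> X]eE lecR.
Qed.

Lemma cvgc_normc u l : u ~~>C l ->
  normc (u n) @[n --> \oo] --> normc l.
Proof.
move=> /cvgcP ul; apply/cvgrPdist_le => e e0.
move/cvgr0Pnorm_le : ul => /(_ _ e0); apply: filterS => n.
rewrite ger0_norm ?normc_ge0//; apply: le_trans.
have hA : normc l <= normc (u n) + normc (u n - l).
  rewrite -(normcN (u n - l)) (le_trans _ (le_normcD _ _))//.
  by rewrite opprB addrC subrK.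
have hB : normc (u n) <= normc (u n - l) + normc l.
  by rewrite (le_trans _ (le_normcD _ _))// subrK.
by rewrite ler_norml; apply/andP; split; lra.
Qed.

Lemma cvgc_complex u (x y : R) :
  complex.Re (u n) @[n --> \oo] --> x -> complex.Im (u n) @[n --> \oo] --> y ->
  u ~~>C (x +i* y).
Proof.
move=> hx hy; apply/cvgcP.
have h0 : `|complex.Re (u n) - x| + `|complex.Im (u n) - y|
    @[n --> \oo] --> (0 : R).
  rewrite -[0 in X in _ --> X]addr0; apply: cvgD; rewrite -(@normr0 _ R);
    apply: cvg_norm.
    by rewrite -(subrr x); apply: cvgB => //; exact: cvg_cst.
  by rewrite -(subrr y); apply: cvgB => //; exact: cvg_cst.
apply: (squeeze_cvgr _ (cvg_cst 0) h0); apply: nearW => n.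
rewrite normc_ge0 (le_trans (normc_le_ReIm _))//.
by case: (u n).
Qed.

(** Completeness of the real numbers, applied to the real and to the imaginary
    parts, gives the completeness needed for complex series. *)
Lemma abs_cvg_series_complex v (M : R) :
  (forall N, \sum_(0 <= n < N) normc (v n) <= M) ->
  exists l, series v ~~>C l.
Proof.
move=> vM.
have key (g : nat -> R) : (forall n, `|g n| <= normc (v n)) -> cvgn (series g).
  move=> gv; apply: normed_cvg; apply: nondecreasing_is_cvgn.
    apply/nondecreasing_seqP => n; rewrite -subr_ge0 seriesSB.
    exact: normr_ge0.
  exists M => _ [N _ <-]; apply: le_trans (vM N).
  by apply: ler_sum => n _; exact: gv.
have /cvg_ex[x hx] :=
  key (fun n => complex.Re (v n)) (fun n => normr_Re_le (v n)).
have /cvg_ex[y hy] :=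
  key (fun n => complex.Im (v n)) (fun n => normr_Im_le (v n)).
exists (x +i* y); apply: cvgc_complex.
- rewrite (_ : (fun n => _) = series (fun n => complex.Re (v n)))//.
  apply/funext => n; rewrite /series /=; apply: esym.
  by elim/big_ind2 : _ => // -[? ?] ? [? ?] ? /= -> ->.
- rewrite (_ : (fun n => _) = series (fun n => complex.Im (v n)))//.
  apply/funext => n; rewrite /series /=; apply: esym.
  by elim/big_ind2 : _ => // -[? ?] ? [? ?] ? /= -> ->.
Qed.

Lemma sum_expr_le (q : R) (K N : nat) : 0 <= q < 1 ->
  \sum_(K <= n < N) q ^+ n <= q ^+ K / (1 - q).
Proof.
move=> /andP[q0 q1]; have q1' : 0 < 1 - q by rewrite subr_gt0.
have [KN|NK] := leqP K N; last first.
  by rewrite (big_geq (ltnW NK)) divr_ge0 ?exprn_ge0// ltW.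
rewrite ler_pdivlMr// (_ : _ * _ = q ^+ K - q ^+ N).
  by rewrite gerBl exprn_ge0.
rewrite mulr_suml -(opprB (q ^+ N)) -(telescope_sumr _ KN) -sumrN.
apply: eq_bigr => n _; rewrite exprS; ring.
Qed.

End ComplexSeries.

(** * The matrix of the composition operator *)

Section AffineCoef.
Variables (R : realType) (a : R).
Hypothesis a01 : 0 < a < 1.

Definition affine_coef (k n : nat) : R := ((a *: 'X + (1 - a)%:P) ^+ n)`_k.

Lemma affine_coef00 : affine_coef 0 0 = 1.
Proof. by rewrite /affine_coef expr0 coef1. Qed.

Lemma affine_coefS0 k : affine_coef k.+1 0 = 0.
Proof. by rewrite /affine_coef expr0 coef1. Qed.

Lemma affine_coef0S n : affine_coef 0 n.+1 = (1 - a) * affine_coef 0 n.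
Proof.
rewrite /affine_coef exprS mulrDl coefD -scalerAl coefZ coefXM coefCM/=.
by rewrite mulr0 add0r.
Qed.

Lemma affine_coefSS k n : affine_coef k.+1 n.+1 =
  a * affine_coef k n + (1 - a) * affine_coef k.+1 n.
Proof.
by rewrite /affine_coef exprS mulrDl coefD -scalerAl coefZ coefXM coefCM.
Qed.

(** Nonnegativity follows from the Pascal-type recursion in n rather than from
    the explicit binomial formula. *)
Lemma affine_coef_ge0 k n : 0 <= affine_coef k n.
Proof.
case/andP: a01 => a0 a1; have b0 : 0 <= 1 - a by rewrite subr_ge0 ltW.
elim: n k => [|n IH] [|k]; rewrite ?affine_coef00 ?affine_coefS0//.
  by rewrite affine_coef0S mulr_ge0.
by rewrite affine_coefSS addr_ge0// mulr_ge0// ltW.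
Qed.

(** Generic in the target ring, so that it gives both the complex expansion of
    (a z + 1 - a)^n and its real majorant. *)
Lemma sum_affine_coef (S : comNzRingType) (g : {rmorphism R -> S}) (t : S)
    (n K : nat) : (n < K)%N ->
  \sum_(0 <= k < K) g (affine_coef k n) * t ^+ k = (g a * t + g (1 - a)) ^+ n.
Proof.
move=> nK; pose p := a *: 'X + (1 - a)%:P.
have sp : (size (map_poly g (p ^+ n)) <= K)%N.
  rewrite (leq_trans (size_poly _ _))// (leq_trans (size_poly_exp_leq _ _))//.
  rewrite (leq_trans _ nK)// ltnS -[leqRHS]mul1n leq_mul2r; apply/orP; right.
  rewrite -subn1 leq_subLR.
  rewrite (leq_trans (size_polyD _ _))// geq_max.
  rewrite (leq_trans (size_scale_leq _ _)) ?size_polyX//=.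
  by rewrite (leq_trans (size_polyC_leq1 _)).
have -> : (g a * t + g (1 - a)) ^+ n = (map_poly g (p ^+ n)).[t].
  rewrite /p rmorphXn/= horner_exp [map_poly g (_ + _)]rmorphD/=.
  by rewrite map_polyZ map_polyX map_polyC !hornerE.
rewrite (horner_coef_wide _ sp) big_mkord; apply: eq_bigr => k _.
by rewrite coef_map.
Qed.

Lemma sum_affine_coef_le (t : R) (n K : nat) : 0 <= t ->
  \sum_(0 <= k < K) affine_coef k n * t ^+ k <= (a * t + (1 - a)) ^+ n.
Proof.
move=> t0; rewrite -(@sum_affine_coef _ idfun t n (maxn K n.+1)); last first.
  by rewrite leq_max leqnn orbT.
rewrite [leRHS](big_cat_nat (n := K)) ?leq_maxl//= lerDl.
by apply: sumr_ge0 => k _; rewrite mulr_ge0 ?exprn_ge0 ?affine_coef_ge0.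
Qed.

(** By the Pascal-type recursion, the partial sum of length N + 1 in row k + 1
    is a times the partial sum of length N in row k plus 1 - a times the one in
    row k + 1; in row 0 the term 1 = a / a takes the place of the former. Both
    are bounded by 1 / a by induction, hence so is their convex combination. *)
Lemma sum_affine_coef_col (k N : nat) :
  \sum_(0 <= n < N) affine_coef k n <= a^-1.
Proof.
case/andP: a01 => a0 a1.
have b0 : 0 <= 1 - a by rewrite subr_ge0 ltW.
have step x y : x <= a^-1 -> y <= a^-1 -> a * x + (1 - a) * y <= a^-1.
  move=> xa ya; rewrite (_ : a^-1 = a * a^-1 + (1 - a) * a^-1); last by ring.
  by rewrite lerD// ler_wpM2l// ltW.
elim: k N => [|k IHk]; (elim=> [|N IHN];
  [by rewrite big_geq// invr_ge0 ltW|rewrite big_nat_recl//=]).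
  under eq_bigr do rewrite affine_coef0S.
  by rewrite -mulr_sumr affine_coef00 -[X in X + _](mulfV (lt0r_neq0 a0)) step.
rewrite affine_coefS0 add0r.
under eq_bigr do rewrite affine_coefSS.
by rewrite big_split/= -!mulr_sumr step.
Qed.

(** A weighted Cauchy-Schwarz inequality: with t the sum squared on the
    left, expand the nonnegative sum of the (x n - a t)^2 weighted by the
    coefficients and use that the total weight is at most 1 / a. *)
Lemma affine_coef_schur (x : nat -> R) (k N : nat) :
  (\sum_(0 <= n < N) x n * affine_coef k n) ^+ 2 <=
  a^-1 * \sum_(0 <= n < N) x n ^+ 2 * affine_coef k n.
Proof.
case/andP: a01 => a0 a1.
set t := \sum_(0 <= n < N) x n * _; set q := \sum_(0 <= n < N) x n ^+ 2 * _.
set w := \sum_(0 <= n < N) affine_coef k n.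
have wa : w <= a^-1 := sum_affine_coef_col k N.
have expand s : \sum_(0 <= n < N) (x n - s) ^+ 2 * affine_coef k n =
    q - 2 * s * t + s ^+ 2 * w.
  rewrite /q /t /w !mulr_sumr -sumrB -big_split/=.
  by apply: eq_bigr => n _; ring.
have : 0 <= \sum_(0 <= n < N) (x n - a * t) ^+ 2 * affine_coef k n.
  by apply: sumr_ge0 => n _; rewrite mulr_ge0 ?sqr_ge0 ?affine_coef_ge0.
rewrite expand.
have : (a * t) ^+ 2 * w <= (a * t) ^+ 2 * a^-1 by rewrite ler_wpM2l ?sqr_ge0.
rewrite [leRHS](_ : _ = a * t ^+ 2); last by field; rewrite gt_eqF.
move=> h1 h2; rewrite mulrC ler_pdivlMr//; move: h1 h2.
rewrite !expr2; nra.
Qed.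
End AffineCoef.

(** * Power series on the unit disk *)

Section PowerSeries.
Variable R : realType.
Implicit Types (c d e : nat -> R[i]) (l z : R[i]).

(** If e vanishes below m, the term of order m is, up to sign, the limit of the
    sum of the later ones. Convergence at 1 / 2 makes e grow at most like 2^n,
    so at a small t > 0 that sum is O(t^(m+1)), which forces
    |e m| t^m = O(t^(m+1)), that is, e m = 0. *)
Lemma power_series_eq0 e :
  (forall z, normc z < 1 ->
    series (fun n => e n * z ^+ n) ~~>C 0) ->
  forall n, e n = 0.
Proof.
move=> e0.
have [B B0 eB] : exists2 B : R, 0 < B & forall n, normc (e n) <= B * 2 ^+ n.
  have h2 : normc (2^-1 : R)%:C = 2^-1 :> R by rewrite normc_realC.
  have h2' : normc (2^-1 : R)%:C < 1 by rewrite h2; lra.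
  have /cvg_ex : exists l : R[i]^o,
      series (fun n => e n * (2^-1 : R)%:C ^+ n) ~~>C l by exists 0; exact: e0.
  move=> /cvg_series_cvg_0 /cvgc_normc; rewrite normc0 => /cvgP.
  move=> /cvg_seq_bounded.
  move=> /bounded_fun_has_ubound[M HM].
  exists (Num.max 1 M) => [|n]; first by rewrite lt_max ltr01.
  rewrite -ler_pdivrMr ?exprn_gt0// -exprVn -h2 -normcX -normcM.
  by rewrite le_max; apply/orP; right; apply: HM; exists n.
elim/ltn_ind => m IH; apply: eq0_normc; apply/eqP.
rewrite eq_le normc_ge0 andbT leNgt; apply/negP => em0.
set x := normc (e m) in em0.
(* The bound on |e m| is linear in t; letting t go to 0 will finish. *)
have small (t : R) : 0 < t <= 4^-1 -> x <= B * 2 ^+ m.+2 * t.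
  move=> /andP[t0 t4].
  have tC : normc t%:C = t by rewrite normc_realC// ltW.
  have /e0/cvgc_normc : normc t%:C < 1 by rewrite tC; lra.
  have h0 : normc (e m * t%:C ^+ m) = x * t ^+ m by rewrite normcM normcX tC.
  rewrite normc0 => lim0.
  (* The m-th term minus the tail bound stays below the modulus of the
     partial sums, whose limit is 0. *)
  have : 0 >= x * t ^+ m - B * ((2 * t) ^+ m.+1 / (1 - 2 * t)).
    apply: (cvgr_to_ge lim0); near=> N.
    have mN : (m < N)%N by near: N; exists m.+1.
    rewrite lerBlDr -h0.
    have -> : e m * t%:C ^+ m = series (fun n => e n * t%:C ^+ n) N
        - \sum_(m.+1 <= n < N) e n * t%:C ^+ n.
      rewrite /series/= (@big_cat_nat _ _ _ m.+1)//= addrK big_nat_recr//=.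
      rewrite big_nat big1 ?add0r// => i /andP[_ /IH ->]; exact: mul0r.
    rewrite (le_trans (le_normcD _ _))// normcN lerD2l.
    rewrite (le_trans (normc_sum _ _ _))//.
    apply: le_trans (_ : B * \sum_(m.+1 <= n < N) (2 * t) ^+ n <= _).
      rewrite mulr_sumr; apply: ler_sum => n _.
      by rewrite normcM normcX tC exprMn mulrA ler_wpM2r ?exprn_ge0 ?(ltW t0).
    by rewrite ler_wpM2l ?(ltW B0)// sum_expr_le//; lra.
  rewrite subr_le0 => h1.
  have tm : 0 < t ^+ m by rewrite exprn_gt0.
  rewrite -(ler_pM2r tm) (le_trans h1)//.
  rewrite exprMn ![_ ^+ m.+1]exprS (exprS _ m.+1) exprS.
  rewrite -!mulrA ler_pM2l// mulrCA !mulrA.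
  have h2m : 0 < (2 : R) ^+ m by rewrite exprn_gt0.
  rewrite ler_pdivrMr; last lra.
  have : 0 < 2 * 2 ^+ m * t * t ^+ m by rewrite !mulr_gt0.
  nra.
set K := B * 2 ^+ m.+2.
have K0 : 0 < K by rewrite mulr_gt0// exprn_gt0.
(* With this t the bound reads x <= K t <= x / 2. *)
pose t := Num.min 4^-1 (x / (2 * K)).
have t0 : 0 < t.
  rewrite lt_min; apply/andP; split; first lra.
  by apply: divr_gt0 => //; apply: mulr_gt0.
have h1 : x <= K * t by apply: small; rewrite t0 ge_min lexx.
have : t <= x / (2 * K) by rewrite ge_min lexx orbT.
have Kt : 0 < K * t by rewrite mulr_gt0.
rewrite ler_pdivlMr; last exact: mulr_gt0.
by rewrite mulrCA (mulrC t) => h2; lra.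
Unshelve. all: by end_near.
Qed.

(** Rearranging the double series needs no Fubini theorem: the matrix is
    triangular, so the K-th partial sums of the two series differ only by
    terms with n >= K, and these are dominated by the geometric tail
    B s^K / (1 - s), where s = a |z| + 1 - a < 1. *)
Lemma power_series_affine_comp (a B : R) c d z l :
  0 < a < 1 -> (forall n, normc (c n) <= B) ->
  (forall k, series (fun n => c n * (affine_coef a k n)%:C) ~~>C d k) ->
  normc z < 1 ->
  series (fun n => c n * (a%:C * z + (1 - a)%:C) ^+ n) ~~>C l ->
  series (fun k => d k * z ^+ k) ~~>C l.
Proof.
move=> a01 cB hd z1; have B0 : 0 <= B := le_trans (normc_ge0 _) (cB 0).
set w := a%:C * z + (1 - a)%:C; set Sw := series _ => hl.
pose s := a * normc z + (1 - a).
have s01 : 0 <= s < 1.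
  case/andP: a01 => a0 a1; have := normc_ge0 z; rewrite /s => z0.
  by apply/andP; split; nra.
pose dN N k := series (fun n => c n * (affine_coef a k n)%:C) N.
(* At a finite stage N the exchange of sums is a finite identity. *)
have partial K N : (K <= N)%N ->
    normc (\sum_(0 <= k < K) dN N k * z ^+ k - Sw K) <= B * (s ^+ K / (1 - s)).
  move=> KN; rewrite /Sw /dN /series/=.
  under eq_bigr do rewrite mulr_suml.
  rewrite exchange_big/= (eq_bigr (fun n =>
    c n * \sum_(0 <= k < K) (affine_coef a k n)%:C * z ^+ k)); last first.
    by move=> n _; rewrite mulr_sumr; apply: eq_bigr => k _; rewrite mulrA.
  rewrite (@big_cat_nat _ _ _ K 0 N)//=.
  rewrite [X in X + _ - _](_ : _ = \sum_(0 <= n < K) c n * w ^+ n); last first.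
    apply: eq_big_nat => n /andP[_ nK]; congr (_ * _).
    exact: (@sum_affine_coef R a _ (real_complex R) z n K nK).
  rewrite addrAC subrr add0r (le_trans (normc_sum _ _ _))//.
  apply: le_trans (_ : B * \sum_(K <= n < N) s ^+ n <= _); last first.
    by rewrite ler_wpM2l// sum_expr_le.
  rewrite mulr_sumr; apply: ler_sum => n _; rewrite normcM.
  apply: ler_pM; rewrite ?normc_ge0//.
  apply: le_trans (sum_affine_coef_le a01 n K (normc_ge0 z)).
  rewrite (le_trans (normc_sum _ _ _))//; apply: ler_sum => k _.
  by rewrite normcM normcX normc_realC ?affine_coef_ge0.
pose Sz := series (fun k => d k * z ^+ k).
have tail K : normc (Sz K - Sw K) <= B * (s ^+ K / (1 - s)).
  have : normc (\sum_(0 <= k < K) dN N k * z ^+ k - Sw K) @[N --> \oo] -->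
      normc (Sz K - Sw K).
    apply: cvgc_normc; apply: cvgB; last exact: cvg_cst.
    apply: cvg_big; first exact: add_continuous.
    by move=> k _; apply: cvgMr_tmp; exact: hd.
  move=> /cvgr_to_le; apply; near=> N; apply: partial; near: N; by exists K.
rewrite -/Sz (_ : Sz = (fun K => (Sz K - Sw K) + Sw K)); last first.
  by apply/funext => K; rewrite subrK.
rewrite -[l]add0r; apply: (@cvgD _ R[i]^o) => //; apply/cvgcP.
have s0 : B * (s ^+ K / (1 - s)) @[K --> \oo] --> (0 : R).
  rewrite -[0](mulr0 B); apply: cvgMl_tmp.
  rewrite -[0](mul0r (1 - s)^-1); apply: cvgMr_tmp.
  by apply: cvg_expr; case/andP: s01 => ? ?; rewrite ger0_norm.
apply: (squeeze_cvgr _ (cvg_cst 0) s0); apply: nearW => K.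
by rewrite normc_ge0 subr0 tail.
Unshelve. all: by end_near.
Qed.

End PowerSeries.

(** * The composition operator on the Hardy space *)

Section HardySpace.
Variable R : realType.
Implicit Types (f : disk_fun R) (c : nat -> R[i]).

Lemma normc_lt1 (z : R[i]) : (`|z| < 1) = (normc z < 1).
Proof. by rewrite normr_normc -(ltcR _ 1). Qed.

Lemma is_taylor_unique f c c' : is_taylor f c -> is_taylor f c' -> c = c'.
Proof.
move=> fc fc'; apply/funext => n; apply/eqP; rewrite -subr_eq0; apply/eqP.
move: n; apply: (@power_series_eq0 R (fun n => c n - c' n)) => z.
rewrite -normc_lt1 => z1.
rewrite (_ : series _ = series (fun n => c n * z ^+ n) -
    series (fun n => c' n * z ^+ n) :> (nat -> R[i]^o)).
  rewrite -(subrr (f (exist _ z z1))).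
  exact: cvgB (fc (exist _ z z1)) (fc' (exist _ z z1)).
apply/funext => N; rewrite fctE /series/= -sumrB.
by apply: eq_bigr => n _; rewrite mulrBl.
Qed.

Lemma taylor_coefE f c : is_taylor f c -> taylor_coef f = c.
Proof.
by move=> fc; apply: (is_taylor_unique _ fc); apply: xgetPex; exists c.
Qed.

(** Since the coefficients are unique, membership in H^2 can be tested on any
    Taylor sequence, and through bounds on real partial sums. *)
Lemma hardy2P f : hardy2 f <-> exists c (Q : R), is_taylor f c /\
  forall N, \sum_(0 <= n < N) normc (c n) ^+ 2 <= Q.
Proof.
split.
  move=> [[c fc]]; rewrite /hardy_normsq (taylor_coefE fc) => fQ.
  exists c, (fine (\sum_(0 <= n <oo) (normc (c n) ^+ 2)%:E)%E); split=> // N.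
  have sq0 n : (0 <= (normc (c n) ^+ 2)%:E)%E by rewrite lee_fin sqr_ge0.
  rewrite -lee_fin fineK; last by rewrite ge0_fin_numE// nneseries_ge0.
  rewrite -sumEFin; exact: nneseries_lim_ge.
move=> [c [Q [fc cQ]]]; split; first by exists c.
rewrite /hardy_normsq (taylor_coefE fc) (@le_lt_trans _ _ Q%:E) ?ltry//.
apply: lime_le.
  by apply: is_cvg_nneseries => n _ _; rewrite lee_fin sqr_ge0.
by apply: nearW => N; rewrite sumEFin lee_fin.
Qed.

Lemma hardy_norm0 : hardy_norm (0 : disk_fun R) = 0.
Proof.
have t0 : is_taylor (0 : disk_fun R) (fun=> 0).
  move=> z; rewrite (_ : series _ = fun=> 0); first exact: cvg_cst.
  by apply/funext => N; rewrite /series/= big1// => n _; rewrite mul0r.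
rewrite /hardy_norm /hardy_normsq (taylor_coefE t0) eseries0 ?sqrtr0//.
by move=> n _ _; rewrite normc0 expr0n.
Qed.

Lemma orbit_span_cyclic (phi : disk R -> disk R) f g :
  hardy2 g -> orbit_span phi f g -> cyclic_subspace phi f g.
Proof.
by move=> g2 gs; split=> // e e0; exists g => //; rewrite subrr hardy_norm0.
Qed.

Section AffineSymbol.
Variables (a : R) (a01 : 0 < a < 1).
Let phi := affine_symbol a01.

(** The Schur test: each row gives |d k|^2 <= 1/a * sum_n |c n|^2 m k n, and
    summing over k uses that the entries m k n of fixed n sum to at most 1. *)
Lemma hardy2_comp_affine f : hardy2 f -> hardy2 (comp_op phi f).
Proof.
case/andP: (a01) => a0 a1.
move=> /hardy2P[c [Q [fc cQ]]].
have cB n : normc (c n) <= Num.sqrt Q.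
  rewrite -[leLHS]ger0_norm ?normc_ge0// -sqrtr_sqr ler_wsqrtr//.
  apply: le_trans (cQ n.+1); rewrite big_nat_recr//= lerDr sumr_ge0// => i _.
  exact: sqr_ge0.
have dex k : exists l,
    series (fun n => c n * (affine_coef a k n)%:C) ~~>C l.
  apply: (@abs_cvg_series_complex _ _ (Num.sqrt Q * a^-1)) => N.
  apply: le_trans (_ : Num.sqrt Q * \sum_(0 <= n < N) affine_coef a k n <= _).
    rewrite mulr_sumr; apply: ler_sum => n _.
    by rewrite normcM normc_realC ?affine_coef_ge0// ler_wpM2r ?affine_coef_ge0.
  by rewrite ler_wpM2l ?sqrtr_ge0// sum_affine_coef_col.
have [d hd] := choice dex.
apply/hardy2P; exists d, (a^-1 * Q); split.
  move=> z; apply: (power_series_affine_comp a01 cB hd); last first.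
    exact: (fc (phi z)).
  by rewrite -normc_lt1; exact: valP z.
move=> K.
have : \sum_(0 <= k < K)
    normc (series (fun n => c n * (affine_coef a k n)%:C) N) ^+ 2
    @[N --> \oo] --> \sum_(0 <= k < K) normc (d k) ^+ 2.
  apply: cvg_big; first exact: add_continuous.
  by move=> k _; rewrite expr2; apply: cvgM; apply: cvgc_normc; exact: hd.
move=> /cvgr_to_le; apply; apply: nearW => N.
apply: le_trans (_ : \sum_(0 <= k < K)
   (a^-1 * \sum_(0 <= n < N) normc (c n) ^+ 2 * affine_coef a k n) <= _).
  apply: ler_sum => k _.
  apply: le_trans (affine_coef_schur a01 (fun n => normc (c n)) k N).
  rewrite lerXn2r ?nnegrE ?normc_ge0//.
    by apply: sumr_ge0 => n _; rewrite mulr_ge0 ?normc_ge0 ?affine_coef_ge0.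
  rewrite (le_trans (normc_sum _ _ _))//; apply: ler_sum => n _.
  by rewrite normcM normc_realC ?affine_coef_ge0.
rewrite -mulr_sumr ler_wpM2l ?invr_ge0 ?(ltW a0)//.
rewrite exchange_big/=; apply: le_trans (cQ N); apply: ler_sum => n _.
rewrite -mulr_sumr -[leRHS]mulr1 ler_wpM2l ?sqr_ge0//.
have := sum_affine_coef_le a01 n K ler01.
rewrite mulr1 [a + _]addrC subrK expr1n; under eq_bigr do rewrite expr1n mulr1.
by [].
Qed.

Lemma affine_symbol_iter n (z : disk R) :
  1 - val (iter n phi z) = (a ^+ n)%:C * (1 - val z).
Proof.
elim: n => [|n IH]; first by rewrite expr0 mul1r.
rewrite iterS [val _]/= exprS rmorphM/= -mulrA -IH rmorphB/= rmorph1; ring.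
Qed.

(** An orbit of phi has no repetition: it converges to the boundary fixed point
    1 at the exact rate a^n. *)
Lemma affine_invariant_infinite (Z : set (disk R)) :
  Z !=set0 -> (forall z, Z z -> Z (phi z)) -> infinite_set Z.
Proof.
case/andP: (a01) => a0 a1.
move=> [w Zw] Zphi finZ; apply: infinite_nat.
pose u n := iter n phi w.
have -> : [set: nat] = u @^-1` Z.
  by apply/seteqP; split=> // n _; rewrite /u/=; elim: n => //= n; exact: Zphi.
apply: finite_preimage => // m n _ _ /(congr1 (fun z => 1 - val z)).
rewrite !affine_symbol_iter.
have w1 : 1 - val w != 0.
  rewrite subr_eq0 eq_sym; apply/eqP => w1.
  by have := valP w; rewrite /= w1 normr1 ltxx.
move=> /(mulIf w1) /complexI; apply: ieexprIn => //.
by rewrite lt_eqF.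
Qed.

Lemma eigenfunction_zeros f (l : R[i]) :
  comp_op phi f = l *: f -> zeros f !=set0 -> infinite_set (zeros f).
Proof.
move=> fl f0; apply: affine_invariant_infinite => // z; rewrite /zeros/= => fz.
rewrite -[f _]/(comp_op phi f z) fl.
by rewrite -[LHS]/(l * f z) fz mulr0.
Qed.
End AffineSymbol.
End HardySpace.

Theorem proposition19 (R : realType) (a : R) (a01 : 0 < a < 1)
    (f : disk_fun R) (f_hardy2 : hardy2 f)
    (zeros_neq0 : zeros f !=set0) (zeros_finite : finite_set (zeros f)) :
  dim_ge (cyclic_subspace (affine_symbol a01) f) 2.
Proof.
pose C := comp_op (affine_symbol a01).
exists (fun i : 'I_2 => iter i C f); split.
  move=> i; apply: orbit_span_cyclic.
    elim: (nat_of_ord i) => [|n IH]; first exact: f_hardy2.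
    by rewrite iterS; exact: hardy2_comp_affine.
  exists i.+1, (fun n : nat => (n == i)%:R); rewrite (bigD1 ord_max)//=.
  rewrite eqxx scale1r big1 ?addr0// => j ji.
  by rewrite -[j == i :> nat]/(j == ord_max) (negbTE ji) scale0r.
move=> k; rewrite big_ord_recl big_ord1/=.
set k0 := k ord0; set k1 := k _ => kf.
have inj : forall l, C f <> l *: f.
  by move=> l /eigenfunction_zeros /(_ zeros_neq0); apply.
have k10 : k1 = 0.
  apply/eqP/negPn/negP => k1n; apply: (inj (- k1^-1 * k0)).
  apply: (scalerI k1n).
  rewrite scalerA mulrA mulrN mulfV// mulN1r scaleNr.
  by apply/eqP; rewrite -addr_eq0 addrC kf.
have k00 : k0 = 0.
  apply/eqP/negPn/negP => k0n.
  move: kf; rewrite k10 scale0r addr0 => /eqP.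
  rewrite scaler_eq0 (negbTE k0n)/= => /eqP f0.
  by apply: (inj 0); rewrite scale0r f0; apply/funext.
move=> i; case: (unliftP ord0 i) => [j ->|-> //].
by rewrite ord1.
Qed.
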